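(* Let $a,b,c,d$ be constants (free parameters) with $|a|+|c|\neq 0$, let $m\ge 0$ be an integer, and put $\sigma_m=\frac{1-(-1)^m}{2}$. Let $S_m(x)=S_m(a,b,c,d;x;q)$ denote the symmetric polynomial solution, $S_m(-x)=(-1)^mS_m(x)$, of the $q$-difference equation $$x^2(ax^2+b)\,D_qD_{q^{-1}}\phi(x)+x(cx^2+d)\,D_q\phi(x)+\left(\lambda_{m,q}x^2-\sigma_m d\right)\phi(x)=0,\qquad \lambda_{m,q}=-[m]_q\left(c-[1-m]_q\,a\right).$$ Then the explicit form of the polynomial $S_m$ is $$S_m(x)=\sum_{k=0}^{[m/2]}q^{(k-1)k}\,x^{m-2k}\,\genfrac{[}{]}{0pt}{}{[m/2]}{k}_{q^2}\ \prod_{j=0}^{[m/2]-k-1}\frac{a\,[2j+\sigma_m+m-1]_q+c\,q^{2j+\sigma_m+m-1}}{b\,[2j+(-1)^{m+1}+2]_q+d\,q^{2j+(-1)^{m+1}+2}} .$$ Moreover, if $a,b\neq 0$, then $$S_m(x)=x^{\sigma_m}\;{}_2\phi_1\!\left(q^{-m+\sigma_m},\ \frac{(a+c(q-1))\,q^{m+\sigma_m-1}}{a};\ \frac{(b+d(q-1))\,q^{2\sigma_m+1}}{b};\ q^2;\ -\frac{a\,q^2x^2}{b}\right).$$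
   Context: Here $0<q<1$, and the parameters are such that the denominators occurring in the formulas do not vanish. $[m/2]$ (without subscript) is the integer part of $m/2$, and the $q$-number is $[z]_q=\frac{q^z-1}{q-1}$. The $q$-difference operator is $D_qf(x)=\frac{f(qx)-f(x)}{(q-1)x}$ for $x\neq 0$, with $D_qf(0)=f'(0)$; $D_{q^{-1}}$ is the same operator with $q$ replaced by $q^{-1}$. For a base $p$, the shifted factorial is $(y;p)_n=\prod_{j=0}^{n-1}(1-p^jy)$, and the $p$-binomial coefficient is $\genfrac{[}{]}{0pt}{}{n}{k}_{p}=\frac{(p;p)_n}{(p;p)_k(p;p)_{n-k}}$ (used here with $p=q^2$). Empty products equal $1$. The basic hypergeometric series with base $p$ is ${}_2\phi_1(\alpha,\beta;\gamma;p;z)=\sum_{k\ge 0}\frac{(\alpha;p)_k(\beta;p)_k}{(p;p)_k(\gamma;p)_k}z^k$, where $\gamma\neq p^{-k}$ for $k=0,1,\dots$ is required for the series to be well defined. Here $p=q^2$ and $\alpha=q^{-m+\sigma_m}=(q^2)^{-[m/2]}$, so the series terminates. The normalization of $S_m$ is the one fixed by the explicit formula (it is not monic in general).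
   Formalization: The second formula is corrected by the factor q^{[m/2]([m/2]-1)} in front of x^{σ_m} 2φ1: with the normalization of the explicit formula the printed equality fails for m≥4 (for m=4, a=b=1, c=d=0, x=0 it reads q^2=1). *)

(* Defs.v *)
From mathcomp Require Import all_boot all_order all_algebra.
From mathcomp Require Import all_classical all_reals all_analysis.
Set Implicit Arguments.
Unset Strict Implicit.
Unset Printing Implicit Defensive.
Import Order.TTheory GRing.Theory Num.Theory.
Import numFieldNormedType.Exports.
Local Open Scope ring_scope.

(* sigma_m = (1 - (-1)^m) / 2 is the parity bit of m; see sigmaE. *)
Definition sigma (m : nat) : nat := odd m.

Lemma sigmaE (m : nat) : (sigma m)%:R = (1 - (-1) ^+ m) / 2 :> rat.
Proof. by rewrite /sigma -signr_odd; case: (odd m). Qed.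

Section QCalculus.
Variable K : numFieldType.

(* The exponent ranges over int: [1 - m]_q is needed. *)
Definition qnum (q : K) (z : int) : K := (q ^ z - 1) / (q - 1).

Definition Dq (q : K) (f : K -> K) (x : K) : K :=
  if x == 0 then derive1 f 0 else (f (q * x) - f x) / ((q - 1) * x).

Definition qpoch (y p : K) (n : nat) : K := \prod_(j < n) (1 - p ^+ j * y).

Definition qbinom (p : K) (n k : nat) : K :=
  qpoch p p n / (qpoch p p k * qpoch p p (n - k)).

Definition phi21 (alpha beta gamma p z : K) : K :=
  limn (series (fun k : nat =>
    qpoch alpha p k * qpoch beta p k / (qpoch p p k * qpoch gamma p k)
    * z ^+ k)).

Definition qlambda (q a c : K) (m : nat) : K :=
  - qnum q m%:Z * (c - qnum q (1 - m%:Z) * a).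

Definition q_equation (q a b c d : K) (m : nat) (phi : K -> K) : Prop :=
  forall x : K,
    x ^+ 2 * (a * x ^+ 2 + b) * Dq q (Dq q^-1 phi) x
    + x * (c * x ^+ 2 + d) * Dq q phi x
    + (qlambda q a c m * x ^+ 2 - (sigma m)%:R * d) * phi x = 0.

(* The degree is only bounded by m: the coefficient of x^m in the explicit
   solution vanishes for some admissible values of a and c.  Without the bound,
   a solution of higher degree with the same parity may exist: for m = 0,
   d = - b / q and c = - a / q, both 1 and 'X^2 solve the equation. *)
Definition symmetric_solution (q a b c d : K) (m : nat) (S : {poly K}) : Prop :=
  [/\ S != 0, (size S <= m.+1)%N,
      forall x : K, S.[- x] = (-1) ^+ m * S.[x]
    & q_equation q a b c d m (fun x => S.[x])].

(* Numerator and denominator of the j-th factor of the product in the explicit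
   formula. *)
Definition S_num (q a c : K) (m j : nat) : K :=
  let e : int := (2 * j + sigma m)%:Z + m%:Z - 1 in
  a * qnum q e + c * q ^ e.

Definition S_den (q b d : K) (m j : nat) : K :=
  let e : int := (2 * j)%:Z + (-1) ^+ m.+1 + 2 in
  b * qnum q e + d * q ^ e.

End QCalculus.

(* Main.v *)
Require Import Defs.
From mathcomp Require Import all_boot all_order all_algebra.
From mathcomp Require Import all_classical all_reals all_analysis.
From mathcomp Require Import ring zify.
Import Order.TTheory GRing.Theory Num.Theory.
Import numFieldNormedType.Exports.
Local Open Scope ring_scope.

(** The difference operator is almost diagonal on monomials: its second and
    first order parts together send x^r to
    - (lambda_r(a, c) x^2 + lambda_r(b, d)) x^r, where lambda_r(a, c) is the
    eigenvalue of degree r and lambda_r(b, d) is the same expression in the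
    other two parameters.  Hence the whole left-hand side of the equation sends
    x^r to A_r x^(r+2) + B_r x^r with
    A_r = lambda_m(a, c) - lambda_r(a, c) and
    B_r = - lambda_r(b, d) - sigma_m d
    ([operator_imageP]).

    A polynomial identity at all points is an identity of coefficients, so for
    a polynomial T = sum_i t_i x^(sigma_m + 2 i) with i <= [m/2] the equation
    becomes the two-term recurrence
    B_(sigma_m + 2 i + 2) t_(i+1) = - A_(sigma_m + 2 i) t_i for i < [m/2]
    ([q_equation_recurrenceP]).  The two remaining coefficients vanish
    by themselves: B_(sigma_m) = 0 at the bottom and A_m = 0 at the top.

    Up to sign, powers of q and a factor q - 1, A_(sigma_m + 2 i) is the
    numerator and B_(sigma_m + 2 i + 2) the denominator of the i-th factor of
    the explicit formula, times q^(2 i) - q^(2 [m/2]) and 1 - q^(2 i + 2)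
    respectively
    ([raising_coefE], [diagonal_coefE]).  Since no denominator vanishes, the
    constant t_0 determines T, so the solutions form a line; and the ratio of
    successive coefficients of the explicit formula ([explicit_coefS]) is the
    one that the recurrence prescribes ([explicit_coef_rec]).  The coefficient
    of index 0 is a power of q, so this solution is not zero even if some
    numerators vanish.

    For a and b nonzero, the numerators and denominators are
    - a (1 - p^i beta) / (q - 1) and - b (1 - p^i gamma) / (q - 1) with
    p = q^2 and the hypergeometric parameters beta, gamma of the statement.  The
    term ratio is then that of a 2phi1 series whose first parameter p^(-[m/2])
    makes it terminate ([explicit_coef_phi21], [phi21_terminating]). *)

(** * Action of the difference operator on monomials *)

Section SymmetricSolution.
Variable K : numFieldType.
Implicit Types (q a b c d x y p : K) (m n r i j k : nat) (T : {poly K}).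

Lemma expr_neq1 q n : 0 < q -> q < 1 -> q ^+ n.+1 != 1.
Proof. by move=> q0 q1; rewrite lt_eqF // exprn_ilt1 // ltW. Qed.

Lemma qnum_subz q r : q != 0 -> qnum q (1 - r%:Z) = (q / q ^+ r - 1) / (q - 1).
Proof. by move=> q0; rewrite /qnum expfzDr // -exprnN expr1z. Qed.

(** The difference operator sends x^r to
    raising_coef x^(r+2) + diagonal_coef x^r. *)
Definition raising_coef q a c m r : K := qlambda q a c m - qlambda q a c r.
Definition diagonal_coef q b d m r : K :=
  - qlambda q b d r - (sigma m)%:R * d.

Definition operator_image q a b c d m T : {poly K} :=
  'X^2 * \poly_(r < size T) (raising_coef q a c m r * T`_r)
  + \poly_(r < size T) (diagonal_coef q b d m r * T`_r).

(** Away from 0 the q-derivatives involve only the values at x, q x and x / q,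
    so the identity holds monomial by monomial.  At 0 the ordinary derivative
    in the definition of the q-derivative is multiplied by 0, and only
    B_0 = - sigma_m d is left on the right. *)
Lemma operator_imageP q a b c d m T x : q != 0 -> q != 1 ->
  x ^+ 2 * (a * x ^+ 2 + b) * Dq q (Dq q^-1 (fun y => T.[y])) x
    + x * (c * x ^+ 2 + d) * Dq q (fun y => T.[y]) x
    + (qlambda q a c m * x ^+ 2 - (sigma m)%:R * d) * T.[x]
  = (operator_image q a b c d m T).[x].
Proof.
move=> q0 q1.
rewrite /operator_image hornerD hornerM hornerXn !horner_poly.
have [->|x0] := eqVneq x 0.
  have diag0 : diagonal_coef q b d m 0 = - (sigma m)%:R * d.
    rewrite /diagonal_coef /qlambda /qnum expr0z subrr !mul0r oppr0 !mul0r.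
    by ring.
  have -> : \sum_(r < size T) diagonal_coef q b d m r * T`_r * 0 ^+ r
          = - (sigma m)%:R * d * T.[0].
    rewrite horner_coef mulr_sumr; apply: eq_bigr => -[[|r] rT] _ /=.
      by rewrite diag0 mulrA.
    by rewrite !expr0n !mulr0.
  by rewrite !expr0n /=; ring.
have qx0 : q * x != 0 by rewrite mulf_neq0.
rewrite /Dq (negbTE x0) (negbTE qx0) mulKf // !horner_coef.
(* Both sides become one sum over the coefficients of T. *)
rewrite mulr_sumr -!sumrB !(mulr_suml, mulr_sumr).
rewrite -!sumrB !(mulr_suml, mulr_sumr) -!big_split /=.
apply: eq_bigr => r _.
rewrite /raising_coef /diagonal_coef /qlambda.
have q1' : q - 1 != 0 by rewrite subr_eq0.
have q1'' : 1 - q != 0 by rewrite subr_eq0 eq_sym.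
rewrite !(qnum_subz q _ q0) /qnum -!exprnP !exprMn exprVn.
have qr0 : q ^+ r != 0 by rewrite expf_neq0.
field.
by rewrite qr0 q0 x0 q1' expf_neq0 // mulN1r.
Qed.

(** * Polynomials of a given parity *)

(** A field of characteristic zero is infinite: the images of the first natural
    numbers would be too many roots of the difference. *)
Lemma poly_horner_inj (P Q : {poly K}) : (forall x, P.[x] = Q.[x]) -> P = Q.
Proof.
move=> PQ; apply/eqP; rewrite -subr_eq0; apply: contraT => nz.
pose rs : seq K := [seq i%:R | i <- iota 0 (size (P - Q))].
have: (size rs < size (P - Q)%R)%N.
  apply: max_poly_roots => //; last first.
    by rewrite map_inj_uniq ?iota_uniq // => i j /eqP; rewrite eqr_nat => /eqP.
  by apply/allP => x _; rewrite rootE !hornerE PQ subrr.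
by rewrite size_map size_iota ltnn.
Qed.

Lemma symmetric_coefP m T :
  (forall x, T.[- x] = (-1) ^+ m * T.[x]) <->
  (forall r, odd r != odd m -> T`_r = 0).
Proof.
pose refl : {poly K} := \poly_(r < size T) ((-1) ^+ r * T`_r).
have reflE x : T.[- x] = refl.[x].
  rewrite horner_poly horner_coef; apply: eq_bigr => r _.
  by rewrite (exprNn x) mulrCA mulrA.
have refl_coef r : refl`_r = (-1) ^+ r * T`_r.
  by rewrite coef_poly; case: ltnP => // ?; rewrite nth_default ?mulr0.
split=> [sym r par|sym x].
  have: refl = (-1) ^+ m *: T.
    by apply: poly_horner_inj => x; rewrite -reflE sym hornerZ.
  move/(congr1 (fun P : {poly K} => P`_r)).
  rewrite refl_coef coefZ -[(-1) ^+ r]signr_odd -[(-1) ^+ m]signr_odd.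
  have nz : T`_r = - T`_r -> T`_r = 0.
    by move/eqP; rewrite -addr_eq0 -mulr2n mulrn_eq0 => /eqP.
  move: par; case: (odd r) (odd m) => [] [] //= _;
    rewrite ?expr0 ?expr1 ?mul1r ?mulN1r => e; apply: nz => //.
rewrite reflE -hornerZ; congr (_.[x]); apply/polyP => r.
rewrite refl_coef coefZ; have [par|par] := eqVneq (odd r) (odd m).
  by rewrite -[(-1) ^+ r]signr_odd par signr_odd.
by rewrite sym ?mulr0.
Qed.

Lemma parityP m r :
  odd r = odd m -> exists i, r = (sigma m + 2 * i)%N.
Proof.
by move=> par; exists r./2; rewrite /sigma -par mul2n odd_double_half.
Qed.

Lemma sigmaD_double_half m : m = (sigma m + 2 * m./2)%N.
Proof. by rewrite /sigma mul2n odd_double_half. Qed.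

Lemma odd_exponent m i : odd (sigma m + 2 * i) = odd m.
Proof. by rewrite oddD mul2n odd_double addbF /sigma; case: (odd m). Qed.

(** The polynomials of degree at most m with the parity of m, given by
    coefficients indexed as powers of x^2. *)
Definition parity_poly m (u : nat -> K) : {poly K} :=
  \sum_(i < (m./2).+1) u i *: 'X^(sigma m + 2 * i).

Lemma coef_parity_poly m u i : (i <= m./2)%N ->
  (parity_poly m u)`_(sigma m + 2 * i) = u i.
Proof.
move=> im; rewrite /parity_poly coef_sum.
rewrite (bigD1 (Ordinal (im : (i < _.+1)%N))) //=.
rewrite coefZ coefXn eqxx mulr1 big1 ?addr0 // => j ji.
rewrite coefZ coefXn eqn_add2l eqn_mul2l /= eq_sym.
by rewrite -[_ == _]/(j == Ordinal (im : (i < _.+1)%N)) (negbTE ji) mulr0.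
Qed.

Lemma parity_poly_odd m u r : odd r != odd m -> (parity_poly m u)`_r = 0.
Proof.
move=> par; rewrite /parity_poly coef_sum big1 // => j _.
rewrite coefZ coefXn; have [rj|_] := eqVneq; last by rewrite mulr0.
by rewrite rj odd_exponent eqxx in par.
Qed.

Lemma size_parity_poly m u : (size (parity_poly m u) <= m.+1)%N.
Proof.
apply: (leq_trans (size_sum _ _ _)); apply/bigmax_leqP => i _.
apply: (leq_trans (size_scale_leq _ _)); rewrite size_polyXn ltnS.
by rewrite [leqRHS]sigmaD_double_half leq_add2l leq_mul2l -ltnS ltn_ord.
Qed.

Lemma parity_polyE m T : (size T <= m.+1)%N ->
  (forall r, odd r != odd m -> T`_r = 0) ->
  T = parity_poly m (fun i => T`_(sigma m + 2 * i)).
Proof.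
move=> sT par; apply/polyP => r.
have [|r_m] := eqVneq (odd r) (odd m); last first.
  by rewrite par // parity_poly_odd.
case/parityP=> i ->; have [im|mi] := leqP i m./2.
  by rewrite coef_parity_poly.
have mr : (m < sigma m + 2 * i)%N.
  by rewrite {1}[m]sigmaD_double_half ltn_add2l ltn_mul2l.
by rewrite !nth_default //; apply: leq_trans mr; rewrite ?size_parity_poly.
Qed.

(** * The equation as a two-term recurrence *)

Lemma coef_operator_image q a b c d m T r :
  (operator_image q a b c d m T)`_r
  = (if (r < 2)%N then 0 else raising_coef q a c m (r - 2) * T`_(r - 2))
    + diagonal_coef q b d m r * T`_r.
Proof.
have coef_scaled (u : nat -> K) j :
    (\poly_(i < size T) (u i * T`_i))`_j = u j * T`_j.
  by rewrite coef_poly; case: ltnP => // ?; rewrite nth_default ?mulr0.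
by rewrite coefD coefXnM !coef_scaled.
Qed.

(** The term - sigma_m d phi of the equation is there for this: it makes the
    lowest coefficient of a solution free. *)
Lemma diagonal_coef_low q b d m r : q != 1 -> (r < 2)%N -> odd r = odd m ->
  diagonal_coef q b d m r = 0.
Proof.
rewrite -subr_eq0 /diagonal_coef /qlambda /qnum /sigma => q1.
case: r => [|[|]] //= _ <- /=; rewrite ?subrr ?expr0z ?expr1z; field; exact: q1.
Qed.

(** The coefficient of x^(sigma_m) in the image vanishes by
    [diagonal_coef_low], that of x^(m+2) because the eigenvalue is the one of
    degree m, and those of the wrong parity because T has none; the remaining
    ones give the recurrence. *)
Lemma q_equation_recurrenceP q a b c d m T : q != 0 -> q != 1 ->
  (size T <= m.+1)%N -> (forall r, odd r != odd m -> T`_r = 0) ->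
  q_equation q a b c d m (fun x => T.[x]) <->
  (forall i, (i < m./2)%N ->
     diagonal_coef q b d m (sigma m + 2 * i.+1) * T`_(sigma m + 2 * i.+1)
     = - (raising_coef q a c m (sigma m + 2 * i) * T`_(sigma m + 2 * i))).
Proof.
move=> q0 q1 sT par.
have exp2 i : (sigma m + 2 * i.+1 = (sigma m + 2 * i).+2)%N by lia.
have [zeroP Pzero] : (q_equation q a b c d m (fun x => T.[x]) ->
       operator_image q a b c d m T = 0) /\
    (operator_image q a b c d m T = 0 ->
       q_equation q a b c d m (fun x => T.[x])).
  split=> [eqT|im0 x]; last by rewrite operator_imageP // im0 horner0.
  by apply: poly_horner_inj => x; rewrite -operator_imageP // horner0 eqT.
split=> [/zeroP im0 i _|rec].
  have := congr1 (fun P : {poly K} => P`_(sigma m + 2 * i.+1)) im0.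
  rewrite /= coef_operator_image coef0 exp2 subn2 /= => /eqP.
  by rewrite addrC addr_eq0 => /eqP.
apply: Pzero; apply/polyP => r; rewrite coef_operator_image coef0.
have [r_m|r_m] := eqVneq (odd r) (odd m); last first.
  rewrite (par _ r_m) mulr0 addr0; case: ltnP => // r2.
  by rewrite par ?mulr0 // oddB // addbF.
case: ltnP => r2; first by rewrite diagonal_coef_low // mul0r addr0.
have [[|i] ri] := parityP _ _ r_m.
  by move: r2; rewrite ri /sigma; case: odd.
rewrite {r r_m r2}ri exp2 subn2 /= -exp2.
have [im|mi|->] := ltngtP i m./2.
- by rewrite rec // subrr.
- have big j : (m./2 < j)%N -> T`_(sigma m + 2 * j) = 0.
    move=> mj; rewrite nth_default //; apply: (leq_trans sT).
    by rewrite {1}[m]sigmaD_double_half ltn_add2l ltn_mul2l.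
  by rewrite !big ?mulr0 ?addr0 // ltnW.
rewrite -sigmaD_double_half /raising_coef subrr mul0r add0r.
rewrite nth_default ?mulr0 //.
apply: (leq_trans sT).
by rewrite {1}[m]sigmaD_double_half ltn_add2l ltn_mul2l /=.
Qed.

(** * Factorization of the coefficients of the recurrence *)

Lemma S_num_exponentE q m j : q != 0 ->
  q ^ ((2 * j + sigma m)%:Z + m%:Z - 1) = q ^+ (sigma m + 2 * j) * q ^+ m / q.
Proof.
move=> q0; rewrite expfzDr // expfzDr // -!exprnP addnC.
by rewrite exprN1.
Qed.

(** The exponent 2 j + (-1)^(m+1) + 2 is 2 j + 1 for even m and 2 j + 3 for
    odd m. *)
Lemma S_den_exponentE q m j :
  q ^ ((2 * j)%:Z + (-1) ^+ m.+1 + 2) = q ^+ (2 * sigma m + 1) * q ^+ (2 * j).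
Proof.
rewrite -exprD [RHS]exprnP; congr (_ ^ _).
by rewrite -signr_odd /= /sigma; case: odd => /=; rewrite ?expr0 ?expr1; lia.
Qed.

(** With r = sigma_m + 2 j, a difference of eigenvalues factors because
    [m]_q [1 - m]_q - [r]_q [1 - r]_q
    = (q^r - q^m) (1 - q^(1 - m - r)) / (q - 1)^2. *)
Lemma raising_coefE q a c m j : q != 0 -> q != 1 ->
  raising_coef q a c m (sigma m + 2 * j)
  = (q ^+ (sigma m + 2 * j) - q ^+ m) * q
    / ((q - 1) * q ^+ m * q ^+ (sigma m + 2 * j)) * S_num q a c m j.
Proof.
move=> q0 q1; have q1' : q - 1 != 0 by rewrite subr_eq0.
rewrite /raising_coef /qlambda /S_num /= !qnum_subz // /qnum S_num_exponentE //.
rewrite -!exprnP.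
have [e1 e2] : q ^+ m != 0 /\ q ^+ (sigma m + 2 * j) != 0 by rewrite !expf_neq0.
field; by rewrite q0 q1' e1 e2.
Qed.

(** The factor q^(2 j + 2) - 1 is (q - 1) [r]_q for even m, where r = 2 j + 2.
    For odd m, where r = 2 j + 3, it is (q - 1) [r - 1]_q, which appears in
    [1 - r]_q = - q^(1 - r) [r - 1]_q and, once sigma_m d is subtracted, in
    [r]_q - 1 = q [r - 1]_q. *)
Lemma diagonal_coefE q b d m j : q != 0 -> q != 1 ->
  diagonal_coef q b d m (sigma m + 2 * j.+1)
  = (q ^+ (2 * j.+1) - 1) / ((q - 1) * q ^+ (sigma m + 2 * j).+1)
    * S_den q b d m j.
Proof.
move=> q0 q1; have q1' : q - 1 != 0 by rewrite subr_eq0.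
rewrite /diagonal_coef /qlambda /S_den /= !qnum_subz // /qnum S_den_exponentE.
rewrite -!exprnP mulnS (exprS _ (_ + _)) !exprD.
have e2 : q ^+ j != 0 by rewrite expf_neq0.
rewrite /sigma; case: odd; rewrite /= ?mulr0n ?mulr1n.
  by field; rewrite q0 q1' e2.
by field; rewrite q0 q1' e2.
Qed.

(** * Coefficients of the explicit formula *)

Lemma qpochS y p n : qpoch y p n.+1 = qpoch y p n * (1 - p ^+ n * y).
Proof. by rewrite /qpoch big_ord_recr. Qed.

Lemma qpoch_neq0 y p n : (forall j, (j < n)%N -> p ^+ j * y != 1) ->
  qpoch y p n != 0.
Proof.
by move=> yp; apply/prodf_neq0 => j _; rewrite subr_eq0 eq_sym yp.
Qed.

Lemma qpoch_qpow_eq0 p n k : p != 0 -> (n < k)%N -> qpoch (p ^- n) p k = 0.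
Proof.
move=> p0 nk; apply/eqP/prodf_eq0; exists (Ordinal nk) => //=.
by rewrite mulfV ?subrr // expf_neq0.
Qed.

Lemma qbinom_shift p i k : (forall j, p ^+ j.+1 != 1) ->
  qbinom p (i + k.+1) k * (1 - p ^+ i.+1)
  = qbinom p (i + k.+1) k.+1 * (1 - p ^+ k.+1).
Proof.
move=> p1; have nz j : qpoch p p j != 0.
  by apply: qpoch_neq0 => ? _; rewrite -exprSr.
rewrite /qbinom addnK (_ : (i + k.+1 - k)%N = i.+1); last by lia.
rewrite !qpochS -!exprSr.
by field; rewrite !nz ![1 - _ == 0]subr_eq0 ![1 == _]eq_sym !p1.
Qed.

(** The coefficient of x^(sigma_m + 2 i); the summation index of the explicit
    formula is k = [m/2] - i. *)
Definition explicit_coef q a b c d m i : K :=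
  let k := (m./2 - i)%N in
  q ^+ (k.-1 * k) * qbinom (q ^+ 2) m./2 k
  * \prod_(j < i) (S_num q a c m j / S_den q b d m j).

Lemma explicit_coef0 q a b c d m :
  explicit_coef q a b c d m 0
  = q ^+ ((m./2).-1 * m./2) * qbinom (q ^+ 2) m./2 m./2.
Proof. by rewrite /explicit_coef subn0 big_ord0 mulr1. Qed.

Lemma qbinom_nn p n : (forall j, p ^+ j.+1 != 1) -> qbinom p n n = 1.
Proof.
move=> p1; rewrite /qbinom subnn {3}/qpoch big_ord0 mulr1 divff //.
by apply: qpoch_neq0 => j _; rewrite -exprSr.
Qed.

(** When i increases by one, k + 1 = [m/2] - i decreases to k.  The power
    q^(k (k + 1)) loses a factor q^(2 k), the binomial gains
    (1 - q^(2 k + 2)) / (1 - q^(2 i + 2)), and the product gains its i-th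
    factor. *)
Lemma explicit_coefS q a b c d m i : 0 < q -> q < 1 -> (i < m./2)%N ->
  explicit_coef q a b c d m i.+1
  = explicit_coef q a b c d m i
    * (q ^+ 2 * ((q ^+ 2) ^+ i / (q ^+ 2) ^+ m./2 - 1) / (1 - (q ^+ 2) ^+ i.+1)
       * (S_num q a c m i / S_den q b d m i)).
Proof.
move=> q0 q1 im; set p := q ^+ 2.
have p0 : p != 0 by rewrite expf_neq0 // gt_eqF.
have p1 j : p ^+ j.+1 != 1.
  by apply: expr_neq1; rewrite ?exprn_gt0 ?exprn_ilt1 // ltW.
have p1' j : 1 - p ^+ j.+1 != 0 by rewrite subr_eq0 eq_sym.
pose k := (m./2 - i.+1)%N.
have nE : m./2 = (i + k.+1)%N by rewrite /k; lia.
rewrite /explicit_coef -/p big_ord_recr /= nE addKn.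
rewrite (_ : (i + k.+1 - i.+1)%N = k); last by lia.
have -> : qbinom p (i + k.+1) k
    = qbinom p (i + k.+1) k.+1 * (1 - p ^+ k.+1) / (1 - p ^+ i.+1).
  by rewrite -qbinom_shift // mulfK.
have -> : q ^+ (k.+1.-1 * k.+1) = q ^+ (k.-1 * k) * p ^+ k.
  by rewrite /p -exprM -exprD; congr (_ ^+ _); case: (k) => //= ?; lia.
rewrite exprD (exprSr p k).
have [pi pk] : p ^+ i != 0 /\ p ^+ k != 0 by split; apply: expf_neq0.
set P := \prod_(_ < i) _; set N := S_num _ _ _ _ _ / _.
by field; rewrite p1' pi pk p0.
Qed.

Lemma explicit_coef_rec q a b c d m i : 0 < q -> q < 1 -> (i < m./2)%N ->
  S_den q b d m i != 0 ->
  diagonal_coef q b d m (sigma m + 2 * i.+1) * explicit_coef q a b c d m i.+1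
  = - (raising_coef q a c m (sigma m + 2 * i) * explicit_coef q a b c d m i).
Proof.
move=> q0 q1 im den; have qn0 : q != 0 by rewrite gt_eqF.
have qn1 : q != 1 by rewrite lt_eqF.
rewrite explicit_coefS // diagonal_coefE // raising_coefE //.
have -> : q ^+ m = q ^+ sigma m * (q ^+ 2) ^+ m./2.
  by rewrite -exprM -exprD -sigmaD_double_half.
have q2i : 1 - q ^+ (2 * i.+1) != 0.
  by rewrite subr_eq0 eq_sym expr_neq1.
rewrite exprD (exprS q (_ + _)) exprD !exprM in q2i *.
set u := explicit_coef _ _ _ _ _ _ _; set v := q ^+ sigma m.
have vn0 : v != 0 by rewrite expf_neq0.
set w := (q ^+ 2) ^+ m./2; have wn0 : w != 0 by rewrite !expf_neq0.
set p := (q ^+ 2) ^+ i; have pn0 : p != 0 by rewrite !expf_neq0.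
rewrite exprS -/p in q2i *.
have q1' : q - 1 != 0 by rewrite subr_eq0.
by field; rewrite q2i q1' pn0 wn0 vn0 den qn0.
Qed.

Lemma diagonal_coef_neq0 q b d m i : 0 < q -> q < 1 ->
  S_den q b d m i != 0 -> diagonal_coef q b d m (sigma m + 2 * i.+1) != 0.
Proof.
move=> q0 q1 den; have qn0 : q != 0 by rewrite gt_eqF.
have qn1 : q != 1 by rewrite lt_eqF.
rewrite diagonal_coefE // !mulf_neq0 ?invr_neq0 ?mulf_neq0 ?expf_neq0 //.
  by rewrite subr_eq0 expr_neq1.
by rewrite subr_eq0.
Qed.

(** * The terminating hypergeometric series *)

Definition phi21_term (alpha beta gamma p z : K) k : K :=
  qpoch alpha p k * qpoch beta p k / (qpoch p p k * qpoch gamma p k) * z ^+ k.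

(** This holds even where a denominator vanishes: the inverse is total, with
    value 0 at 0, and multiplicative. *)
Lemma phi21_termS (alpha beta gamma p z : K) k :
  phi21_term alpha beta gamma p z k.+1
  = phi21_term alpha beta gamma p z k
    * ((1 - p ^+ k * alpha) * (1 - p ^+ k * beta)
       / ((1 - p ^+ k.+1) * (1 - p ^+ k * gamma)) * z).
Proof. by rewrite /phi21_term !qpochS -exprSr (exprSr z) !invfM; ring. Qed.

(** The numerator factor 1 - p^n p^(-n) is zero, so the partial sums are
    constant from rank n + 1 on. *)
Lemma phi21_terminating (beta gamma p z : K) n : p != 0 ->
  phi21 (p ^- n) beta gamma p z
  = \sum_(k < n.+1) phi21_term (p ^- n) beta gamma p z k.
Proof.
move=> p0; apply: lim_near_cst; first exact: norm_hausdorff.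
near=> N; have nN : (n.+1 <= N)%N by near: N; exact: nbhs_infty_ge.
rewrite /series /= (big_cat_nat _ nN) //= big_mkord.
rewrite [X in _ + X = _]big_nat [X in _ + X = _]big1 ?addr0 // => k /andP[nk _].
by rewrite qpoch_qpow_eq0 // !mul0r.
Unshelve. all: by end_near. Qed.

(** Both sides have the same term ratio: the factors a / b and - q^2 left by the
    numerator, the denominator and the binomial are those of the
    argument - a q^2 x^2 / b. *)
Lemma explicit_coef_phi21 q a b c d m i x : 0 < q -> q < 1 ->
  a != 0 -> b != 0 ->
  (i <= m./2)%N ->
  explicit_coef q a b c d m i * (x ^+ 2) ^+ i
  = explicit_coef q a b c d m 0
    * phi21_term ((q ^+ 2) ^- m./2)
        ((a + c * (q - 1)) * q ^ (m%:Z + (sigma m)%:Z - 1) / a)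
        ((b + d * (q - 1)) * q ^+ (2 * sigma m + 1) / b)
        (q ^+ 2) (- (a * q ^+ 2 * x ^+ 2 / b)) i.
Proof.
move=> q0 q1 a0 b0; have qn0 : q != 0 by rewrite gt_eqF.
have q1' : q - 1 != 0 by rewrite subr_eq0 lt_eqF.
set beta := _ / a; set gamma := _ / b.
have numE j : S_num q a c m j = - a / (q - 1) * (1 - (q ^+ 2) ^+ j * beta).
  rewrite /S_num /= /qnum S_num_exponentE // /beta.
  rewrite expfzDr // expfzDr // -!exprnP exprN1.
  rewrite exprD exprM.
  by field; rewrite qn0 q1' a0.
have denE j : S_den q b d m j = - b / (q - 1) * (1 - (q ^+ 2) ^+ j * gamma).
  rewrite /S_den /= /qnum S_den_exponentE // /gamma.
  rewrite (exprM q 2 j).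
  by field; rewrite q1' b0.
elim: i => [|i IH] im.
  rewrite expr0 mulr1 /phi21_term /qpoch !big_ord0 !(mulr1, expr0).
  by rewrite divr1 mulr1.
rewrite explicit_coefS // (exprSr (x ^+ 2)) mulrACA IH 1?ltnW //.
rewrite phi21_termS [RHS]mulrA.
congr (_ * _).
rewrite numE denE !invfM !invrK.
(* With the inverses common to both sides made opaque, what is left is an
   identity polynomial in them. *)
set g := (1 - _ * gamma)^-1; set h := (1 - _)^-1.
by field; rewrite b0 q1' !expf_neq0.
Qed.

End SymmetricSolution.

Arguments parity_poly {K}.
Arguments explicit_coef {K}.

(** * Symmetric polynomial solutions *)

Theorem theorem3p3 (K : numFieldType) (q a b c d : K) (m : nat)
    (hq0 : 0 < q) (hq1 : q < 1)
    (hac : `|a| + `|c| != 0)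
    (hden : forall j : nat, (j < m./2)%N -> S_den q b d m j != 0) :
  exists S : {poly K},
    [/\ forall T : {poly K}, symmetric_solution q a b c d m T <->
          (exists2 e : K, e != 0 & T = e *: S),
        forall x : K,
          S.[x] = \sum_(k < (m./2).+1)
            q ^+ (k.-1 * k) * x ^+ (m - 2 * k) * qbinom (q ^+ 2) m./2 k
            * \prod_(j < m./2 - k) (S_num q a c m j / S_den q b d m j)
      & a != 0 -> b != 0 ->
        (forall k : nat,
          (b + d * (q - 1)) * q ^+ (2 * sigma m + 1) / b != (q ^+ 2) ^- k) ->
        forall x : K,
          S.[x] = q ^+ ((m./2).-1 * m./2) * (x ^+ sigma m *
            phi21 (q ^ (- m%:Z + (sigma m)%:Z))
              ((a + c * (q - 1)) * q ^ (m%:Z + (sigma m)%:Z - 1) / a)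
              ((b + d * (q - 1)) * q ^+ (2 * sigma m + 1) / b)
              (q ^+ 2)
              (- (a * q ^+ 2 * x ^+ 2 / b)))].
Proof.
have q0 : q != 0 by rewrite gt_eqF.
have q1 : q != 1 by rewrite lt_eqF.
have p1 j : (q ^+ 2) ^+ j.+1 != 1.
  by apply: expr_neq1; rewrite ?exprn_gt0 ?exprn_ilt1 // ltW.
pose u := explicit_coef q a b c d m.
have u0E : u 0%N = q ^+ ((m./2).-1 * m./2).
  by rewrite /u explicit_coef0 qbinom_nn // mulr1.
have u0 : u 0%N != 0 by rewrite u0E expf_neq0.
exists (parity_poly m u); split.
- move=> T; split=> [[T0 sT /symmetric_coefP par]|[e e0 ->]].
    move/(q_equation_recurrenceP _ _ _ _ _ _ _ _ q0 q1 sT par) => rec.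
    pose t i := T`_(sigma m + 2 * i).
    have TE : T = parity_poly m t by exact: parity_polyE.
    (* Division by B_(sigma_m + 2 i + 2), which is not zero, makes T a multiple
       of the explicit solution, coefficient by coefficient. *)
    have tE i : (i <= m./2)%N -> t i = t 0%N / u 0%N * u i.
      elim: i => [|i IH] im; first by rewrite divfK.
      apply: (mulfI (diagonal_coef_neq0 _ _ _ _ _ _ hq0 hq1 (hden _ im))).
      rewrite rec // mulrCA explicit_coef_rec ?hden // mulrN.
      by rewrite -/(t i) IH 1?ltnW // mulrCA.
    have TS : T = (t 0%N / u 0%N) *: parity_poly m u.
      rewrite {1}TE /parity_poly scaler_sumr; apply: eq_bigr => i _.
      by rewrite scalerA -tE // -ltnS.
    exists (t 0%N / u 0%N) => //.
    by apply: contra_neq T0 => e0; rewrite TS e0 scale0r.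
  have sS : (size (e *: parity_poly m u) <= m.+1)%N.
    by rewrite (leq_trans (size_scale_leq _ _)) ?size_parity_poly.
  have par r : odd r != odd m -> (e *: parity_poly m u)`_r = 0.
    by move=> ?; rewrite coefZ parity_poly_odd ?mulr0.
  split=> //.
  (* The lowest coefficient is a power of q times e. *)
  + apply: contra_neq u0.
    move/(congr1 (fun P : {poly K} => P`_(sigma m + 2 * 0))).
    rewrite coefZ coef_parity_poly // coef0 => /eqP.
    by rewrite mulf_eq0 (negbTE e0) => /eqP.
  + exact/symmetric_coefP.
  + apply/q_equation_recurrenceP => // i im.
    rewrite !coefZ !coef_parity_poly // 1?ltnW //.
    by rewrite mulrCA explicit_coef_rec ?hden // mulrN mulrCA.
- move=> x; rewrite /parity_poly horner_sum (reindex_inj rev_ord_inj) /=.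
  apply: eq_bigr => k _; have km : (k <= m./2)%N by rewrite -ltnS.
  rewrite hornerZ hornerXn subSS /u /explicit_coef subKn //.
  have -> : (sigma m + 2 * (m./2 - k) = m - 2 * k)%N.
    by have := sigmaD_double_half m; lia.
  by ring.
move=> a0 b0 _ x.
have -> : q ^ (- m%:Z + (sigma m)%:Z) = (q ^+ 2) ^- m./2.
  rewrite -exprM exprnN; congr (_ ^ _).
  by have := sigmaD_double_half m; lia.
rewrite phi21_terminating ?expf_neq0 // -u0E mulrCA mulr_sumr.
rewrite /parity_poly horner_sum mulr_sumr; apply: eq_bigr => i _.
rewrite hornerZ hornerXn -explicit_coef_phi21 // -1?ltnS //.
by rewrite exprD exprM mulrCA.
Qed.
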